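(* Suppose that Assumption 1 holds (see context), and let $(z^k)_{k\in\mathbb{N}}$ (together with the auxiliary iterates $v^k,u^k,\tilde z_i^k$) be generated by the SPIRAL algorithm described in the context. Then: (i) for every $k\in\mathbb{N}$, $\mathcal{L}(v^{k+1},z^{k+1}) \le \mathcal{L}(v^k,z^k) - \sum_{i=1}^N D_{\hat h_i}(z^{k+1},\tilde z_i^k)$, where $\hat h_i=\frac{1}{\gamma_i}h_i-\frac1N f_i$; (ii) for every $i\in\{1,\dots,N\}$, $D_{\hat h_i}(z^{k+1},\tilde z_i^k)\to 0$ as $k\to\infty$; (iii) the sequences $(\mathcal{L}(v^k,z^k))_{k\in\mathbb{N}}$ and $(\varphi(z^k))_{k\in\mathbb{N}}$ both converge to a common value $\varphi_\star$ with $\varphi(z^0)\ge\varphi_\star\ge\inf\varphi$; (iv) $\varphi(z^\star)=\varphi_\star$ for every cluster point $z^\star$ of $(z^k)_{k\in\mathbb{N}}$; (v) every cluster point $z^\star$ of $(z^k)_{k\in\mathbb{N}}$ is a fixed point of $\operatorname{prox}_\varphi^{\hat h}$, i.e. $z^\star\in\operatorname{prox}_\varphi^{\hat h}(z^\star)$, and in particular is stationary for $\varphi$, i.e. $0\in\hat\partial\varphi(z^\star)$; (vi) if $\varphi$ is level bounded, then $(z^k)_{k\in\mathbb{N}}$ and $(\tilde z_i^k)_{k\in\mathbb{N}}$, $i\in\{1,\dots,N\}$, are bounded.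
   Context: Problem: minimize over $z\in\mathbb{R}^n$ the function $\varphi(z)=f(z)+g(z)$, with $f=\frac1N\sum_{i=1}^N f_i$. Write $[N]=\{1,\dots,N\}$. A distance-generating function (dgf) is a strictly convex, continuously differentiable function $h:\mathbb{R}^n\to\mathbb{R}$; its Bregman distance is $D_h(y,x)=h(y)-h(x)-\langle\nabla h(x),y-x\rangle$. A function $f:\mathbb{R}^n\to\mathbb{R}$ is $L$-smooth relative to $h$ ($L\ge0$) if $Lh+f$ and $Lh-f$ are convex on $\mathbb{R}^n$. Assumption 1: (a) for each $i\in[N]$, $f_i:\mathbb{R}^n\to\mathbb{R}$ is $L_i$-smooth relative to a dgf $h_i:\mathbb{R}^n\to\mathbb{R}$; (b) $g:\mathbb{R}^n\to\mathbb{R}\cup\{\infty\}$ is proper and lower semicontinuous (not necessarily convex); (c) $\arg\min\varphi\ne\emptyset$. Notation. Fix stepsizes $\gamma_i\in(0,N/L_i)$ (with $N/0=\infty$). Set $\hat h_i=\frac1{\gamma_i}h_i-\frac1N f_i$ and $\hat h=\sum_{i=1}^N\hat h_i$ (these are dgfs). Define the set-valued mappings $$T(s)=\arg\min_{w\in\mathbb{R}^n}\Big\{g(w)+\sum_{i=1}^N\tfrac1{\gamma_i}h_i(w)-\langle s,w\rangle\Big\},\qquad \operatorname{prox}_\varphi^{\hat h}(z)=\arg\min_{w\in\mathbb{R}^n}\{\varphi(w)+D_{\hat h}(w,z)\},$$ so that $\operatorname{prox}_\varphi^{\hat h}=T\circ\nabla\hat h$. Define $\mathcal{L}(y,x)=\varphi(y)+D_{\hat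 h}(y,x)$, evaluated at pairs with $y\in T(\nabla\hat h(x))$. SPIRAL algorithm. Parameters: $z^{\rm init}\in\mathbb{R}^n$, $\beta\in(0,1)$, maximum number of backtracks $q_{\max}\in\mathbb{N}\cup\{\infty\}$. Initialize $s^0=\nabla\hat h(z^{\rm init})$. For $k=0,1,2,\dots$: 1. Choose $z^k\in T(s^k)$. 2. Choose $v^k\in T(\nabla\hat h(z^k))$. 3. Choose a direction $d^k\in\mathbb{R}^n$ (arbitrary). 4. (Linesearch) Set $\tau_k=1$, $q_k=0$. Repeat: set $u^k=\tau_kz^k+(1-\tau_k)v^k+\tau_kd^k$ and choose $y^k\in T(\nabla\hat h(u^k))$; if $\mathcal{L}(y^k,u^k)\le\mathcal{L}(v^k,z^k)$, stop; else if $q_k=q_{\max}$, set $u^k=v^k$ and stop; else replace $\tau_k$ by $\beta\tau_k$, $q_k$ by $q_k+1$, and repeat. 5. (Incremental loop) Set $s=\nabla\hat h(u^k)$. For $\ell=1,\dots,N$: pick $i^\ell\in[N]$ (at random) without replacement, so that $(i^1,\dots,i^N)$ is a permutation of $[N]$ which may depend on $k$; choose $\tilde z^k_{i^\ell}\in T(s)$; replace $s$ by $s+\nabla\hat h_{i^\ell}(\tilde z^k_{i^\ell})-\nabla\hat h_{i^\ell}(u^k)$. 6. Set $s^{k+1}=s$ (hence $s^{k+1}=\sum_{i=1}^N\nabla\hat h_i(\tilde z_i^k)$). Here an infinite sequence generated by the algorithm is considered. The regular subdifferential $\hat\partial\varphi(\bar x)$ is the set of $v$ with $\liminf_{x\to\bar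 x,\,x\neq\bar x}\frac{\varphi(x)-\varphi(\bar x)-\langle v,x-\bar x\rangle}{\|x-\bar x\|}\ge0$. A function is level bounded if all its sublevel sets $\{x:\varphi(x)\le\alpha\}$, $\alpha\in\mathbb{R}$, are bounded. *)

(* Defs.v *)
From HB Require Import structures.
From mathcomp Require Import all_boot all_order all_algebra perm.
From mathcomp Require Import all_classical all_reals all_analysis.

Set Implicit Arguments.
Unset Strict Implicit.
Unset Printing Implicit Defensive.

Import Order.TTheory GRing.Theory Num.Theory.
Import numFieldNormedType.Exports.

Local Open Scope classical_set_scope.
Local Open Scope ring_scope.

Section Euclidean.
Context {R : realType} {n : nat}.
Implicit Types (u v x y z : 'rV[R]_n) (h f : 'rV[R]_n -> R).
Implicit Types (F : 'rV[R]_n -> \bar R).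

Definition dot u v : R := \sum_j u 0 j * v 0 j.

(* The library norm on 'rV[R]_n is the sup norm, so the Euclidean norm is
   spelled out; the topology and the bounded sets are the same for both. *)
Definition enorm u : R := Num.sqrt (dot u u).

(* Row vector of the partial derivatives. *)
Definition grad h x : 'rV[R]_n := \row_j 'D_(delta_mx 0 j) h x.

Definition bregman h y x : R := h y - h x - dot (grad h x) (y - x).

Definition strictly_convex h : Prop :=
  forall x y (t : R), x != y -> 0 < t < 1 ->
    h (t *: x + (1 - t) *: y) < t * h x + (1 - t) * h y.

(* Distance-generating function. *)
Definition dgf h : Prop :=
  [/\ strictly_convex h, forall x, differentiable h x & continuous (grad h)].

Definition relatively_smooth (L : R) f h : Prop :=
  convex_function [set: 'rV[R]_n] (fun x => L * h x + f x) /\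
  convex_function [set: 'rV[R]_n] (fun x => L * h x - f x).

Definition proper F : Prop :=
  (forall x, (-oo < F x)%E) /\ exists x, (F x < +oo)%E.

Definition argmin F : set 'rV[R]_n := [set w | forall w', (F w <= F w')%E].

Definition level_bounded F : Prop :=
  forall a : R, bounded_set [set x | (F x <= a%:E)%E].

(* The filter x^' of deleted neighborhoods encodes "x' -> x, x' <> x". *)
Definition regular_subdifferential F x : set 'rV[R]_n :=
  [set v | (0 <= limf_einf
     (fun x' => (F x' - F x - (dot v (x' - x))%:E) * ((enorm (x' - x))^-1)%:E)
     x^')%E].

End Euclidean.

Section Spiral.
Context {R : realType} {n N : nat}.
Variables (f h : 'I_N -> 'rV[R]_n -> R) (L : 'I_N -> R).
Variables (g : 'rV[R]_n -> \bar R) (gamma : 'I_N -> R).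

Definition phi (z : 'rV[R]_n) : \bar R :=
  ((N%:R^-1 * \sum_i f i z)%:E + g z)%E.

Record standing_assumption : Prop := StandingAssumption {
  L_ge0 : forall i, 0 <= L i;
  h_dgf : forall i, dgf (h i);
  f_relatively_smooth : forall i, relatively_smooth (L i) (f i) (h i);
  g_proper : proper g;
  g_lsc : lower_semicontinuous g;
  argmin_phi_neq0 : argmin phi !=set0
}.

(* gamma_i lies in (0, N / L_i), with N / 0 read as +oo (whereas x / 0 = 0 in
   the library). *)
Definition admissible_stepsizes : Prop :=
  forall i, 0 < gamma i /\ (L i != 0 -> gamma i < N%:R / L i).

Definition hhat_ (i : 'I_N) (w : 'rV[R]_n) : R :=
  (gamma i)^-1 * h i w - N%:R^-1 * f i w.

Definition hhat (w : 'rV[R]_n) : R := \sum_i hhat_ i w.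

Definition T (s : 'rV[R]_n) : set 'rV[R]_n :=
  argmin (fun w => (g w + (\sum_i (gamma i)^-1 * h i w)%:E - (dot s w)%:E)%E).

Definition prox (z : 'rV[R]_n) : set 'rV[R]_n :=
  argmin (fun w => (phi w + (bregman hhat w z)%:E)%E).

Definition lyap (y x : 'rV[R]_n) : \bar R :=
  (phi y + (bregman hhat y x)%:E)%E.

(* [linesearch beta qmax z v d tau q u]: the backtracking loop, entered with
   current values tau and q, terminates and returns u.  The number qmax of
   allowed backtracks is None when it is infinite; being inductive, the
   relation only describes terminating loops. *)
Inductive linesearch (beta : R) (qmax : option nat) (z v d : 'rV[R]_n) :
    R -> nat -> 'rV[R]_n -> Prop :=
| Accept tau q u y of
    u = tau *: z + (1 - tau) *: v + tau *: d &
    y \in T (grad hhat u) & (lyap y u <= lyap v z)%E :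
    linesearch beta qmax z v d tau q u
| GiveUp tau q u y of
    u = tau *: z + (1 - tau) *: v + tau *: d &
    y \in T (grad hhat u) & ~~ (lyap y u <= lyap v z)%E &
    qmax = Some q :
    linesearch beta qmax z v d tau q v
| Backtrack tau q u y u' of
    u = tau *: z + (1 - tau) *: v + tau *: d &
    y \in T (grad hhat u) & ~~ (lyap y u <= lyap v z)%E &
    qmax <> Some q &
    linesearch beta qmax z v d (beta * tau) q.+1 u' :
    linesearch beta qmax z v d tau q u'.

(* One pass over all indices in the order given by the permutation p; sigma l
   is the value of s after l inner iterations, and s' the final one. *)
Definition incremental_loop (u : 'rV[R]_n) (ztilde : 'I_N -> 'rV[R]_n)
    (s' : 'rV[R]_n) : Prop :=
  exists (p : {perm 'I_N}) (sigma : nat -> 'rV[R]_n),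
    [/\ sigma 0%N = grad hhat u,
        forall l : 'I_N, ztilde (p l) \in T (sigma l),
        forall l : 'I_N, sigma l.+1 =
          sigma l + grad (hhat_ (p l)) (ztilde (p l)) - grad (hhat_ (p l)) u &
        s' = sigma N].

Record spiral (zinit : 'rV[R]_n) (beta : R) (qmax : option nat)
    (s z v d u : nat -> 'rV[R]_n) (ztilde : nat -> 'I_N -> 'rV[R]_n) : Prop :=
  Spiral {
  spiral_init : s 0%N = grad hhat zinit;
  spiral_z : forall k, z k \in T (s k);
  spiral_v : forall k, v k \in T (grad hhat (z k));
  spiral_u : forall k, linesearch beta qmax (z k) (v k) (d k) 1 0 (u k);
  spiral_inner : forall k, incremental_loop (u k) (ztilde k) (s k.+1)
}.

End Spiral.

(* Main.v *)
Require Import Defs.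
From HB Require Import structures.
From mathcomp Require Import all_boot all_order all_algebra perm.
From mathcomp Require Import all_classical all_reals all_analysis.
From mathcomp Require Import lra ring.

(* Relative smoothness makes each hhat_i convex and differentiable, so all
   Bregman distances D_i of the hhat_i are nonnegative and hhat is C^1.  For
   s = sum_i grad hhat_i (a_i), T s is the set of minimizers of
   phi + sum_i D_i(., a_i).  Replacing the centre a_j = u by the current
   minimizer kills the j-th term there and so cannot increase the minimum;
   hence phi(z^{k+1}) + sum_i D_i(z^{k+1}, ztilde_i^k) is at most the minimum of
   phi + D(., u^k), which the linesearch bounds by lyap(v^k, z^k).  With
   lyap(v^k, z^k) <= phi(z^k) this gives the descent and the common limit
   phistar.  Letting z^k approach a cluster point zstar in
   phistar <= lyap(v^k, z^k) <= phi(w) + D(w, z^k) gives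
   phistar <= phi(w) + D(w, zstar) for all w, while phi(zstar) <= phistar by
   lower semicontinuity.  All iterates stay in one sublevel set of phi. *)

Set Implicit Arguments.
Unset Strict Implicit.
Unset Printing Implicit Defensive.

Import Order.TTheory GRing.Theory Num.Theory.
Import numFieldNormedType.Exports.

Local Open Scope classical_set_scope.
Local Open Scope ring_scope.

(** * The pairing [dot], gradients and first-order expansions *)

Section Differentiability.
Context {R : realType} {n : nat}.
Implicit Types (u v w x y : 'rV[R]_n) (F : 'rV[R]_n -> R).

Lemma dot_is_linear u : linear (dot u : 'rV[R]_n -> R).
Proof.
move=> a v w; rewrite /dot scaler_sumr -big_split/=; apply: eq_bigr => j _.
by rewrite !mxE mulrDr mulrCA.
Qed.

HB.instance Definition _ u :=
  GRing.isLinear.Build R 'rV[R]_n R _ (dot u) (dot_is_linear u).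

Lemma dotDl u v w : dot (u + v) w = dot u w + dot v w.
Proof. by rewrite /dot -big_split; apply: eq_bigr => j _; rewrite mxE mulrDl. Qed.

Lemma dot_suml (I : Type) (r : seq I) (P : pred I) (u_ : I -> 'rV[R]_n) w :
  dot (\sum_(i <- r | P i) u_ i) w = \sum_(i <- r | P i) dot (u_ i) w.
Proof.
apply: (big_morph (dot^~ w)) => [u v|]; first exact: dotDl.
by rewrite /dot big1 // => j _; rewrite mxE mul0r.
Qed.

Lemma cvg_dot {T : Type} (G : set_system T) {FG : Filter G}
    (a b : T -> 'rV[R]_n) u v :
  a @ G --> u -> b @ G --> v -> dot (a t) (b t) @[t --> G] --> dot u v.
Proof.
move=> au bv; rewrite /dot; apply: cvg_big; first exact: add_continuous.
move=> j _.
have coord_cvg (c : T -> 'rV[R]_n) (l : 'rV[R]_n) :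
    c @ G --> l -> c t 0 j @[t --> G] --> (l 0 j : R).
  move=> cl.
  exact: (cvg_comp c (fun M : 'rV[R]_n => M 0 j) cl (@coord_continuous _ _ _ 0 j l)).
by apply: cvgM; exact: coord_cvg.
Qed.

Lemma dot_continuous u : continuous (dot u).
Proof.
move=> x.
exact: (@cvg_dot _ (nbhs x) _ (fun=> u) id u x (cvg_cst u) cvg_id).
Qed.

(** The square of each coordinate is one summand of [dot x x]. This turns errors measured in the sup
    norm into errors relative to the Euclidean norm. *)
Lemma norm_le_enorm x : `|x| <= enorm x.
Proof.
have le_enorm i : `|x 0 i| <= enorm x.
  rewrite -sqrtr_sqr ler_wsqrtr// /dot (bigD1 i)//= -expr2 lerDl.
  by apply: sumr_ge0 => j _; rewrite -expr2 sqr_ge0.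
rewrite [leLHS]mx_normrE; apply: bigmax_le; first exact: sqrtr_ge0.
by move=> [i j] _/=; rewrite ord1.
Qed.

Lemma differentiable_le F x u :
  (forall e, 0 < e -> \forall v \near (0 : 'rV[R]_n),
    `|F (x + v) - F x - dot u v| <= e * `|v|) ->
  differentiable F x.
Proof.
move=> H; apply/diffP => /=.
(* The differential is picked by [get] among continuous linear maps with the first-order expansion,
   so exhibiting one such map, [dot u], suffices. *)
apply: (@getPex _ (fun (df : {linear 'rV[R]_n -> R}) => continuous df /\
  forall y, F y = F (lim (nbhs x)) + df (y - lim (nbhs x))
                  +o_(y \near x) (y - lim (nbhs x)))).
exists (dot u : {linear 'rV[R]_n -> R}); split; first exact: dot_continuous.
rewrite lim_id//.
suff : F = (fun y => F x + dot u (y - x)) +o_ (nbhs x) (fun y => y - x).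
  by rewrite funeqE.
apply/eqaddoP => e e0.
have sub_x : (fun y => y - x) @ x --> (0 : 'rV[R]_n).
  rewrite -(subrr x).
  exact: (@cvgB _ _ _ (nbhs x) _ id (fun=> x) x x cvg_id (cvg_cst x)).
apply: (@filterS _ (nbhs x) _ _ _ _ (sub_x _ (H e e0))) => y /=.
by rewrite [x + _]addrC subrK -[X in _ -> X <= _]/(`|F y - (F x + _)|) opprD addrA.
Qed.

Lemma dot_gradE F x v : differentiable F x -> dot (grad F x) v = 'd F x v.
Proof.
move=> dF; rewrite [v in RHS]row_sum_delta linear_sum /dot; apply: eq_bigr => j _.
by rewrite linearZ/= mxE deriveE// mulrC.
Qed.

Lemma differentiable_grad_le F x e : differentiable F x -> 0 < e ->
  \forall v \near (0 : 'rV[R]_n),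
    `|F (x + v) - F x - dot (grad F x) v| <= e * `|v|.
Proof.
move=> dF e0; move: (dF) => /diff_locally /eqaddoP/(_ _ e0); apply: filterS => v.
rewrite /= dot_gradE// -[X in X <= _ -> _]/(`|F (v + x) - (F x + 'd F x v)|).
by rewrite [v + x]addrC opprD addrA.
Qed.

Lemma grad_sum m (F : 'I_m -> 'rV[R]_n -> R) x :
  (forall i, differentiable (F i) x) ->
  grad (fun y => \sum_i F i y) x = \sum_i grad (F i) x.
Proof.
move=> dF; apply/rowP => j; rewrite summxE mxE.
have -> : (fun y => \sum_i F i y) = \sum_i F i by apply/funext => y; rewrite fct_sumE.
rewrite derive_sum//; first by apply: eq_bigr => i _; rewrite mxE.
by move=> i; exact: diff_derivable.
Qed.

Lemma bregmanxx F x : bregman F x x = 0.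
Proof. by rewrite /bregman !subrr linear0 subrr. Qed.

End Differentiability.

(** * Convex functions: difference quotients, directional derivatives, gradients *)

Section Convexity.
Context {R : realType} {n : nat}.
Implicit Types (u v w x y : 'rV[R]_n) (F G : 'rV[R]_n -> R) (r s t e : R).

Lemma convex_functionP F : convex_function [set: 'rV[R]_n] F <->
  forall x y t, 0 <= t <= 1 ->
    F (t *: x + (1 - t) *: y) <= t * F x + (1 - t) * F y.
Proof.
split => [cF x y t t01|cF t x y _ _]; last first.
  by apply: (cF x y t%:num); rewrite ge0 le1.
have t01' : Itv.spec (@Itv.num_sem R) (Itv.Real `[0%Z, 1%Z]) t.
  by apply/and3P; split; rewrite ?num_real ?bnd_simp//; case/andP: t01.
exact: (cF (Itv.mk t01') x y (in_setT _) (in_setT _)).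
Qed.

Definition slope F x v t : R := t^-1 * (F (x + t *: v) - F x).

Lemma slope1 F x v : slope F x v 1 = F (x + v) - F x.
Proof. by rewrite /slope invr1 mul1r scale1r. Qed.

Lemma slope_approx F x v e : differentiable F x -> 0 < e ->
  exists2 t, 0 < t <= 1 & `|slope F x v t - dot (grad F x) v| <= e.
Proof.
move=> dF e0.
(* The added 1 keeps the divisor positive when [v = 0]; the error along [t *: v] is then still at
   most [e * t]. *)
have d0 : 0 < e / (`|v| + 1) by rewrite divr_gt0// ltr_wpDl.
have tv0 : t *: v @[t --> 0^'+] --> (0 : 'rV[R]_n).
  rewrite -[X in _ --> X](scale0r v); apply: cvgZr_tmp.
  exact: cvg_at_right_filter cvg_id.
near (0 : R)^'+ => t.
have t0 : 0 < t by near: t; exact: nbhs_right_gt.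
exists t; first by rewrite t0/=; near: t; apply: nbhs_right_le; exact: ltr01.
have : `|F (x + t *: v) - F x - dot (grad F x) (t *: v)|
    <= e / (`|v| + 1) * `|t *: v|.
  by near: t; apply: (tv0 [set w | `|F (x + w) - F x - dot (grad F x) w|
    <= e / (`|v| + 1) * `|w|]); exact: differentiable_grad_le.
rewrite linearZ/= normrZ gtr0_norm// => le_t.
have -> : slope F x v t - dot (grad F x) v =
    t^-1 * (F (x + t *: v) - F x - t * dot (grad F x) v).
  by rewrite [RHS]mulrBr mulKf// gt_eqF.
rewrite normrM gtr0_norm ?invr_gt0// mulrC ler_pdivrMr// (le_trans le_t)//.
rewrite mulrCA mulrC ler_pM2r// mulrAC ler_pdivrMr ?ltr_wpDl//.
by rewrite ler_pM2l// lerDl.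
Unshelve. all: by end_near. Qed.

Section OneFunction.
Variables (F : 'rV[R]_n -> R).
Hypothesis cF : convex_function [set: 'rV[R]_n] F.

(** The point [x + s *: v] is the convex combination of [x + t *: v] and [x] with weight [s / t] on
    the former. *)
Lemma slope_nondecreasing x v s t : 0 < s -> s <= t ->
  slope F x v s <= slope F x v t.
Proof.
move=> s0 st; have t0 := lt_le_trans s0 st.
have st1 : 0 <= s / t <= 1 by rewrite divr_ge0 ?(ltW s0) ?(ltW t0)//= ler_pdivrMr ?mul1r.
move/convex_functionP: cF => /(_ (x + t *: v) x _ st1).
have -> : (s / t) *: (x + t *: v) + (1 - s / t) *: x = x + s *: v.
  rewrite scalerDr scalerA divfK ?gt_eqF// scalerBl scale1r.
  by rewrite addrC addrA subrK.
by move=> le_s; rewrite /slope ler_pdivrMl// mulrA; lra.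
Qed.

(** The step doubles because [x + t *: (v + w)] is the midpoint of [x + (2 * t) *: v] and
    [x + (2 * t) *: w]. *)
Lemma slopeD_le x v w t : 0 < t ->
  slope F x (v + w) t <= slope F x v (2 * t) + slope F x w (2 * t).
Proof.
move=> t0; have half01 : 0 <= (2^-1 : R) <= 1 by lra.
move/convex_functionP: cF => /(_ (x + (2 * t) *: v) (x + (2 * t) *: w) _ half01).
have -> : 2^-1 *: (x + (2 * t) *: v) + (1 - 2^-1) *: (x + (2 * t) *: w) =
    x + t *: (v + w) by apply/rowP => j; rewrite !mxE; field.
move=> le_t; rewrite /slope -mulrDr ler_pdivrMl// mulrA.
by rewrite (_ : t / (2 * t) = 2^-1); [lra|field; rewrite gt_eqF].
Qed.

(** Subadditivity applied to [v] and [- v], whose sum has zero quotient. It bounds the quotients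
    along [v] from below, so that their infimum is meaningful. *)
Lemma slope_opp_ge0 x v s t : 0 < s -> 0 < t ->
  0 <= slope F x v s + slope F x (- v) t.
Proof.
(* Half the minimum, so that the doubled step [2 * r] is at most both [s] and [t]. *)
move=> s0 t0; set r := Num.min s t / 2.
have r0 : 0 < r by rewrite divr_gt0// lt_min s0.
apply: (@le_trans _ _ (slope F x (v + - v) r)).
  by rewrite /slope subrr scaler0 addr0 subrr mulr0.
apply: (le_trans (slopeD_le _ _ _ r0)); rewrite mulrC divfK//.
by apply: lerD; apply: slope_nondecreasing; rewrite ?lt_min ?s0// ge_min lexx ?orbT.
Qed.

(** The one-sided directional derivative: the quotients are nondecreasing in [t], so their limit at
    0 from the right is this infimum. *)
Definition dirder x v : R := inf [set slope F x v t | t in `]0, +oo[ ].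

Lemma le_dirder x v e : (forall t, 0 < t -> e <= slope F x v t) ->
  e <= dirder x v.
Proof.
move=> le_e; apply: lb_le_inf.
  by exists (slope F x v 1), 1 => //=; rewrite in_itv/= ltr01.
by move=> _ /= [t + <-]; rewrite in_itv/= andbT => /le_e.
Qed.

Lemma dirder_le x v t : 0 < t -> dirder x v <= slope F x v t.
Proof.
move=> t0; apply: ge_inf; last by exists t; rewrite //= in_itv/= t0.
exists (- slope F x (- v) 1) => _ /= [s + <-]; rewrite in_itv/= andbT => s0.
by have := slope_opp_ge0 x v s0 ltr01; lra.
Qed.

Lemma dirderD_le x v w : dirder x (v + w) <= dirder x v + dirder x w.
Proof.
(* Each infimum on the right gets its own step, [s] or [t]; half of their minimum serves both. *)
rewrite -lerBlDr; apply: le_dirder => s s0; rewrite lerBlDr -lerBlDl.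
apply: le_dirder => t t0; rewrite lerBlDl.
set r := Num.min s t / 2.
have r0 : 0 < r by rewrite divr_gt0// lt_min s0.
apply: (le_trans (dirder_le _ _ r0)).
apply: (le_trans (slopeD_le _ _ _ r0)); rewrite mulrC divfK//.
by apply: lerD; apply: slope_nondecreasing; rewrite ?lt_min ?s0// ge_min lexx ?orbT.
Qed.

Lemma dirderZ_le x v r : 0 < r -> dirder x (r *: v) <= r * dirder x v.
Proof.
move=> r0; rewrite -ler_pdivrMl//; apply: le_dirder => t t0.
rewrite ler_pdivrMl// (le_trans (dirder_le _ _ (divr_gt0 t0 r0)))//.
rewrite /slope scalerA divfK ?gt_eqF// invf_div mulrA.
by rewrite [r * _]mulrC.
Qed.

Lemma dirderZ x v r : 0 < r -> dirder x (r *: v) = r * dirder x v.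
Proof.
move=> r0; apply/eqP; rewrite eq_le dirderZ_le//=.
have ri0 : 0 < r^-1 by rewrite invr_gt0.
have := dirderZ_le x (r *: v) ri0.
by rewrite scalerA mulVf ?gt_eqF// scale1r ler_pdivlMl.
Qed.

Lemma dirder0 x : dirder x 0 = 0.
Proof.
have slope0 t : slope F x 0 t = 0 by rewrite /slope scaler0 addr0 subrr mulr0.
apply/eqP; rewrite eq_le -{1}(slope0 1) dirder_le//=.
by apply: le_dirder => t _; rewrite slope0.
Qed.

Lemma dirder_opp_ge0 x v : 0 <= dirder x v + dirder x (- v).
Proof. by rewrite -(dirder0 x) -(subrr v) dirderD_le. Qed.

(** The quotient at step 1 dominates those at smaller steps, which come arbitrarily close to
    [dot (grad F x) v]. *)
Lemma convex_dot_grad_le x v : differentiable F x ->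
  dot (grad F x) v <= F (x + v) - F x.
Proof.
move=> dF; rewrite -slope1; apply/ler_addgt0Pr => e e0.
have [t /andP[t0 t1]] := slope_approx v dF e0.
by have := slope_nondecreasing x v t0 t1; rewrite ler_norml; lra.
Qed.

Lemma convex_bregman_ge0 x y : differentiable F x -> 0 <= bregman F y x.
Proof.
move=> /(convex_dot_grad_le (y - x)).
by rewrite [x + _]addrC subrK /bregman subr_ge0.
Qed.

(** The gradient inequality at [y], tested on a fixed small [w], bounds [dot (grad F y) w] by
    [F (y + w) - F y]. This is close to [F (x + w) - F x] by continuity of [F], hence to
    [dot (grad F x) w] by differentiability at [x]. Taking [w] along both signs of each basis vector
    bounds every coordinate. *)
Lemma convex_continuous_grad : (forall x, differentiable F x) ->
  continuous (grad F).
Proof.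
move=> dF x; apply/(@cvgrPdist_le _ _ _ (nbhs x)) => e e0.
have e20 : 0 < e / 2 by rewrite divr_gt0.
have /nbhs_norm0P[d /= d0 small] := differentiable_grad_le (dF x) e20.
set r := d / 2; have r0 : 0 < r by rewrite divr_gt0.
(* The bound [e * r] is the sum of two halves: the first-order remainder at [x] and the variation of
   [F (y + w) - F y] for [y] near [x]. *)
have test (j : 'I_n) (b : R) : `|b| = r -> \forall y \near x,
    b * (grad F y 0 j - grad F x 0 j) <= e * r.
  move=> br; set w := b *: (delta_mx 0 j : 'rV[R]_n).
  have dot_w u : dot u w = b * u 0 j.
    rewrite linearZ/= /dot (bigD1 j)//= mxE !eqxx mulr1 big1 ?addr0// => k kj.
    by rewrite mxE (negbTE kj) andbF mulr0.
  have w_le : `|w| <= r.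
    rewrite [leLHS]mx_normrE; apply: bigmax_le; first exact: ltW.
    move=> [k l] _ /=; rewrite !mxE normrM br.
    by case: (_ && _); rewrite ?normr1 ?mulr1// normr0 mulr0 ltW.
  have w_small : `|F (x + w) - F x - dot (grad F x) w| <= e / 2 * r.
    apply: le_trans (small w _) _; last by rewrite ler_pM2l.
    by rewrite /= (le_lt_trans w_le)// /r ltr_pdivrMr// ltr_pMr// ltr1n.
  have er0 : 0 < e * r / 2 by rewrite divr_gt0// mulr_gt0.
  have cont : (fun y => F (y + w) - F y) @ x --> F (x + w) - F x.
    have add_w : (fun y => y + w) @ x --> x + w.
      exact: (@cvgD _ _ _ (nbhs x) _ id (fun=> w) x w cvg_id (cvg_cst w)).
    have Fw := cvg_comp _ F add_w (differentiable_continuous (dF (x + w))).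
    exact: (cvgB Fw (differentiable_continuous (dF x))).
  move/cvgrPdist_le : cont => /(_ _ er0); apply: filterS => y le_y.
  have := convex_dot_grad_le w (dF y).
  move: w_small le_y; rewrite !dot_w !ler_norml mulrBr; lra.
have near_test (b : R) : `|b| = r -> \forall y \near x,
    forall j, b * (grad F y 0 j - grad F x 0 j) <= e * r.
  move=> br; apply: (@filter_forall _ _ (fun j y =>
    b * (grad F y 0 j - grad F x 0 j) <= e * r) (nbhs x)) => j; exact: test.
near=> y.
have pos : forall j, r * (grad F y 0 j - grad F x 0 j) <= e * r.
  by near: y; apply: near_test; rewrite gtr0_norm.
have neg : forall j, - r * (grad F y 0 j - grad F x 0 j) <= e * r.
  by near: y; apply: near_test; rewrite normrN gtr0_norm.
rewrite [leLHS]mx_normrE; apply: bigmax_le; first exact: ltW.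
move=> [i j] _ /=; rewrite !ord1 3!mxE.
move: (pos j) (neg j); rewrite mulNr -mulrN ![r * _]mulrC !ler_pM2r// !mxE ler_norml.
by move=> le_pos le_neg; apply/andP; lra.
Unshelve. all: by end_near. Qed.

End OneFunction.

(* The one-sided derivatives [p] of [F] and [q] of [G] are sublinear and
   [p + q] is at most the linear derivative of [F + G], so that
   [p v + p (- v) = 0 = q v + q (- v)]: [p] is linear. *)
Lemma convex_differentiable_of_sum F G x :
  convex_function [set: 'rV[R]_n] F -> convex_function [set: 'rV[R]_n] G ->
  differentiable (fun y => F y + G y) x -> differentiable F x.
Proof.
move=> cF cG dS; set S := (fun y => F y + G y) in dS.
pose p := dirder F x; pose q := dirder G x.
have pq_le v : p v + q v <= dot (grad S x) v.
  apply/ler_addgt0Pr => e e0; have [t /andP[t0 _]] := slope_approx v dS e0.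
  have -> : slope S x v t = slope F x v t + slope G x v t.
    by rewrite /slope /S -mulrDr; congr (_ * _); lra.
  have := dirder_le cF x v t0; have := dirder_le cG x v t0.
  by rewrite -/(p v) -/(q v) ler_norml; lra.
have dotN v : dot (grad S x) (- v) = - dot (grad S x) v by rewrite linearN.
have pN v : p (- v) = - p v.
  have := pq_le v; have := pq_le (- v); rewrite dotN.
  have := dirder_opp_ge0 cF x v; have := dirder_opp_ge0 cG x v.
  by rewrite -/(p v) -/(p _) -/(q v) -/(q _); lra.
have pqE v : p v + q v = dot (grad S x) v.
  have := pq_le v; have := pq_le (- v); rewrite dotN.
  have := dirder_opp_ge0 cF x v; have := dirder_opp_ge0 cG x v.
  by rewrite -/(p v) -/(p _) -/(q v) -/(q _); lra.
have p0 : p 0 = 0 by exact: dirder0.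
have pD v w : p (v + w) = p v + p w.
  apply/eqP; rewrite eq_le dirderD_le//=.
  have := dirderD_le cF x (v + w) (- w).
  by rewrite addrK -/(p v) -/(p _) -/(p (- w)) pN; lra.
have pZ r v : p (r *: v) = r * p v.
  have [r0|r0|->] := ltgtP r 0; last by rewrite scale0r mul0r.
    by rewrite -[r]opprK scaleNr pN mulNr /p dirderZ// oppr_gt0.
  by rewrite /p dirderZ.
pose a : 'rV[R]_n := \row_j p (delta_mx 0 j).
have pE v : p v = dot a v.
  rewrite [v in LHS]row_sum_delta (big_morph p pD p0) /dot; apply: eq_bigr => j _.
  by rewrite pZ mxE mulrC.
(* Since [p] and [q] lie below the quotients at step 1, the remainders of [F] and [G] are
   nonnegative. They add up to that of [F + G], so each is at most [e] times the norm of [v]. *)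
apply: (@differentiable_le _ _ F x a) => e e0.
apply: filterS (differentiable_grad_le dS e0) => v.
rewrite -pqE -pE !ler_norml /S.
have := dirder_le cF x v ltr01; have := dirder_le cG x v ltr01.
rewrite !slope1 -/(p v) -/(q v) => qv pv /andP[le1 le2].
have : 0 <= e * `|v| by rewrite mulr_ge0// ltW.
by move=> ev0; apply/andP; lra.
Qed.

End Convexity.

(** * Relative smoothness and the differentiability it forces *)

Section RelativeSmoothness.
Context {R : realType} {n : nat}.
Implicit Types (x y : 'rV[R]_n) (f h F G : 'rV[R]_n -> R).

Lemma strictly_convex_convex h :
  strictly_convex h -> convex_function [set: 'rV[R]_n] h.
Proof.
move=> ch; apply/convex_functionP => x y t /andP[t0 t1].
have [->|xy] := eqVneq x y; first by rewrite -scalerDl -mulrDl subrKC scale1r mul1r.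
move: t0; rewrite le_eqVlt => /predU1P[<-|t0].
  by rewrite subr0 scale0r !mul0r !add0r scale1r mul1r.
move: t1; rewrite le_eqVlt => /predU1P[->|t1].
  by rewrite subrr scale0r mul0r !addr0 scale1r mul1r.
by apply/ltW/ch; rewrite ?t0.
Qed.

Lemma convex_functionD F G :
  convex_function [set: 'rV[R]_n] F -> convex_function [set: 'rV[R]_n] G ->
  convex_function [set: 'rV[R]_n] (fun x => F x + G x).
Proof.
move=> /convex_functionP cF /convex_functionP cG; apply/convex_functionP => x y t t01.
by have := cF x y t t01; have := cG x y t t01; lra.
Qed.

Lemma convex_functionZ (c : R) F : 0 <= c ->
  convex_function [set: 'rV[R]_n] F ->
  convex_function [set: 'rV[R]_n] (fun x => c * F x).
Proof.
move=> c0 /convex_functionP cF; apply/convex_functionP => x y t t01.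
rewrite mulrCA [_ * (c * _)]mulrCA -mulrDr.
by rewrite ler_wpM2l// cF.
Qed.

(** The convex functions [L * h + f] and [L * h - f] sum to the differentiable [2 * L * h], so the
    first is differentiable; subtracting [L * h] leaves [f]. *)
Lemma relatively_smooth_differentiable (L : R) f h x :
  relatively_smooth L f h -> differentiable h x -> differentiable f x.
Proof.
move=> [cA cB] dh.
have dA : differentiable (fun y => L * h y + f y) x.
  apply: convex_differentiable_of_sum cA cB _.
  have -> : (fun y => L * h y + f y + (L * h y - f y)) = (2 * L) *: h.
    by apply/funext => y; rewrite -[RHS]/(2 * L * h y); ring.
  exact: differentiableZ.
have -> : f = (fun y => L * h y + f y) - L *: h.
  by apply/funext => y; rewrite -[RHS]/(L * h y + f y - L * h y); ring.
by apply: differentiableB => //; exact: differentiableZ.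
Qed.

End RelativeSmoothness.

(** * Convexity and smoothness of the [hhat_i] and their Bregman distances *)

Section Spiral.
Context {R : realType} {n N : nat}.
Variables (f h : 'I_N -> 'rV[R]_n -> R) (L : 'I_N -> R).
Variables (g : 'rV[R]_n -> \bar R) (gamma : 'I_N -> R).
Hypothesis assum : standing_assumption f h L g.
Hypothesis gammaP : admissible_stepsizes L gamma.
Implicit Types (i : 'I_N) (x y w z u v : 'rV[R]_n) (a : 'I_N -> 'rV[R]_n).

Local Notation hhat_i := (hhat_ f h gamma).
Local Notation hhat := (hhat f h gamma).
Local Notation phi := (phi f g).
Local Notation T := (T h g gamma).
Local Notation lyap := (lyap f h g gamma).
Local Notation D i := (bregman (hhat_i i)).

Lemma f_differentiable i x : differentiable (f i) x.
Proof.
apply: relatively_smooth_differentiable (f_relatively_smooth assum i) _.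
by case: (h_dgf assum i).
Qed.

Lemma hhat_i_differentiable i x : differentiable (hhat_i i) x.
Proof.
have -> : hhat_i i = (gamma i)^-1 *: h i - N%:R^-1 *: f i by apply/funext.
apply: differentiableB; apply: differentiableZ; last exact: f_differentiable.
by case: (h_dgf assum i).
Qed.

(** A combination of the convex [h i] and [L i * h i - f i]; the stepsize bound makes the
    coefficient of [h i] nonnegative. The case [L i = 0] is separate, since the upper bound on
    [gamma i] is then absent. *)
Lemma hhat_i_convex i : convex_function [set: 'rV[R]_n] (hhat_i i).
Proof.
have N0 : 0 < N%:R :> R by rewrite ltr0n (leq_ltn_trans _ (ltn_ord i)).
have [g0 gL] := gammaP i.
have c0 : 0 <= (gamma i)^-1 - L i / N%:R.
  have [->|L0] := eqVneq (L i) 0; first by rewrite mul0r subr0 invr_ge0 ltW.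
  have Lp : 0 < L i by rewrite lt_def L0 (L_ge0 assum).
  rewrite subr_ge0 -[L i / _]invf_div lef_pV2 ?posrE ?divr_gt0//.
  exact/ltW/gL.
have -> : hhat_i i = fun x =>
    ((gamma i)^-1 - L i / N%:R) * h i x + N%:R^-1 * (L i * h i x - f i x).
  by apply/funext => x; rewrite /hhat_; ring.
apply: convex_functionD; apply: convex_functionZ => //.
- by apply: strictly_convex_convex; case: (h_dgf assum i).
- by case: (f_relatively_smooth assum i).
Qed.

Lemma bregman_hhat_i_ge0 i x y : 0 <= D i y x.
Proof. exact: convex_bregman_ge0 (hhat_i_convex i) _ _ (hhat_i_differentiable i x). Qed.

Lemma hhat_differentiable x : differentiable hhat x.
Proof.
have -> : hhat = \sum_i hhat_i i by apply/funext => y; rewrite fct_sumE.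
by apply: differentiable_sum => i; exact: hhat_i_differentiable.
Qed.

Lemma grad_hhatE x : grad hhat x = \sum_i grad (hhat_i i) x.
Proof. by apply: grad_sum => i; exact: hhat_i_differentiable. Qed.

Lemma bregman_hhatE y x : bregman hhat y x = \sum_i D i y x.
Proof.
by rewrite /bregman grad_hhatE dot_suml /Defs.hhat -!sumrB.
Qed.

Lemma bregman_hhat_ge0 y x : 0 <= bregman hhat y x.
Proof. by rewrite bregman_hhatE sumr_ge0// => i _; exact: bregman_hhat_i_ge0. Qed.

Lemma hhat_continuous_grad : continuous (grad hhat).
Proof.
apply: convex_continuous_grad hhat_differentiable.
apply/convex_functionP => x y t t01; rewrite /Defs.hhat !mulr_sumr -big_split/=.
by apply: ler_sum => i _; have /convex_functionP := hhat_i_convex i; exact.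
Qed.

Lemma bregman_hhat_continuous w : continuous (bregman hhat w).
Proof.
move=> x.
have cvg_sub : (fun y => w - y) @ x --> w - x.
  exact: (@cvgB _ _ _ (nbhs x) _ (fun=> w) id w x (cvg_cst w) cvg_id).
have cvg_h : (fun y => hhat w - hhat y) @ x --> hhat w - hhat x.
  exact: cvgB (cvg_cst _) (differentiable_continuous (hhat_differentiable x)).
have cvg_d := @cvg_dot _ _ _ (nbhs x) (nbhs_filter x) _ _ _ _
  (@hhat_continuous_grad x) cvg_sub.
exact: (@cvgB _ _ _ (nbhs x) _ (fun y => hhat w - hhat y) _ _ _ cvg_h cvg_d).
Qed.

Lemma phi_gtNy x : (-oo < phi x)%E.
Proof.
case: (g_proper assum) => /(_ x) + _; rewrite /Defs.phi.
by case: (g x) => [r _|_|]; [rewrite -EFinD ltNyr|rewrite addey//|rewrite ltxx].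
Qed.

(** * The map [T] with one centre per index, and the descent within one iteration *)

Definition bregman_sum y a : R := \sum_i D i y (a i).

Lemma bregman_sum_ge0 y a : 0 <= bregman_sum y a.
Proof. by apply: sumr_ge0 => i _; exact: bregman_hhat_i_ge0. Qed.

(** As [(gamma i)^-1 * h i] is [hhat_i i] plus [f i] divided by [N], the two objectives differ by a
    constant in [w], collected in [c]. *)
Lemma T_sum_gradP a y : T (\sum_i grad (hhat_i i) (a i)) y <->
  forall w, (phi y + (bregman_sum y a)%:E <= phi w + (bregman_sum w a)%:E)%E.
Proof.
set s := \sum_i _.
pose c := \sum_i (hhat_i i (a i) - dot (grad (hhat_i i) (a i)) (a i)).
have objE w : (g w + (\sum_i (gamma i)^-1 * h i w)%:E - (dot s w)%:E =
    phi w + (bregman_sum w a)%:E + c%:E)%E.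
  rewrite /Defs.phi [((_)%:E + g w)%E]addeC -!addeA -EFinB -!EFinD; congr (_ + _%:E)%E.
  rewrite /bregman_sum /c dot_suml mulr_sumr -sumrB -!big_split/=.
  apply: eq_bigr => i _; rewrite /bregman /hhat_ linearB/=; ring.
split=> Ty w; first by have := Ty w; rewrite !objE leeD2rE.
by rewrite /= !objE leeD2rE.
Qed.

(** The case of all centres equal to [u], which is the identity of [prox] with [T] composed with
    [grad hhat]. *)
Lemma T_grad_hhatP u y : T (grad hhat u) y <->
  forall w, (lyap y u <= lyap w u)%E.
Proof.
have sumE w : bregman_sum w (fun=> u) = bregman hhat w u by rewrite bregman_hhatE.
rewrite grad_hhatE (T_sum_gradP (fun=> u)).
by split=> Ty w; have := Ty w; rewrite !sumE.
Qed.

Lemma phi_le_lyap y x : (phi y <= lyap y x)%E.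
Proof. by rewrite leeDl// lee_fin bregman_hhat_ge0. Qed.

Lemma T_grad_hhat_lyap_le u y : T (grad hhat u) y -> (lyap y u <= phi u)%E.
Proof. by move/T_grad_hhatP/(_ u); rewrite {2}/Defs.lyap bregmanxx adde0. Qed.

Lemma incremental_loop_descent u (zt : 'I_N -> 'rV[R]_n) s' y0 :
  incremental_loop f h g gamma u zt s' -> T (grad hhat u) y0 ->
  (forall y, T s' y -> (phi y + (bregman_sum y zt)%:E <= lyap y0 u)%E) /\
  forall i, (phi (zt i) <= lyap y0 u)%E.
Proof.
move=> [p [sigma [sigma0 Tzt sigmaS ->]]] Ty0.
(* The centre of index [i] after [l] inner steps: [(p^-1)%g i] is the position at which [i] is
   visited, and the centre stays [u] until then. *)
pose a l i := if ((p^-1)%g i < l)%N then zt i else u.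
have a_lt (l : 'I_N) : a l (p l) = u by rewrite /a permK ltnn.
have aS_lt (l : 'I_N) : a l.+1 (p l) = zt (p l) by rewrite /a permK ltnSn.
have aS_neq (l : 'I_N) i : i != p l -> a l.+1 i = a l i.
  move=> ipl; rewrite /a ltnS leq_eqVlt; case: eqP => //= il; move: ipl.
  by rewrite -(val_inj il) permKV eqxx.
have sigmaE l : (l <= N)%N -> sigma l = \sum_i grad (hhat_i i) (a l i).
  elim: l => [_|l IH lN]; first by rewrite sigma0 grad_hhatE.
  have := sigmaS (Ordinal lN); rewrite /= => ->; rewrite (IH (ltnW lN)).
  rewrite (bigD1 (p (Ordinal lN)))//= [RHS](bigD1 (p (Ordinal lN)))//=.
  rewrite (a_lt (Ordinal lN)) (aS_lt (Ordinal lN)).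
  rewrite [in RHS](eq_bigr _ (fun i ip => congr1 _ (aS_neq _ i ip))).
  by rewrite addrAC [X in X - _]addrC addrK addrC.
(* Only the centre of the visited index changes, and the new one is the evaluation point itself, so
   that its term drops to 0. *)
have sum_le l (lN : (l < N)%N) :
    bregman_sum (zt (p (Ordinal lN))) (a l.+1) <=
    bregman_sum (zt (p (Ordinal lN))) (a l).
  rewrite /bregman_sum (bigD1 (p (Ordinal lN)))//= [leRHS](bigD1 (p (Ordinal lN)))//=.
  rewrite (aS_lt (Ordinal lN)) bregmanxx.
  rewrite (eq_bigr _ (fun i ip => congr1 _ (aS_neq (Ordinal lN) i ip))).
  by rewrite lerD2r bregman_hhat_i_ge0.
(* A minimizer for the new centres is compared with the current inner iterate, which minimizes for
   the old ones. *)
have descent l : (l <= N)%N -> forall y, T (sigma l) y ->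
    (phi y + (bregman_sum y (a l))%:E <= lyap y0 u)%E.
  elim: l => [_ y|l IH lN y].
    rewrite sigma0 => /T_grad_hhatP/(_ y0); rewrite {1}/Defs.lyap bregman_hhatE.
    by [].
  rewrite sigmaE// => /T_sum_gradP/(_ (zt (p (Ordinal lN)))) /le_trans; apply.
  have Tz : T (sigma l) (zt (p (Ordinal lN))).
    by have := Tzt (Ordinal lN); rewrite in_setE.
  apply: le_trans (IH (ltnW lN) _ Tz).
  by rewrite leeD2l// lee_fin sum_le.
split=> [y Ty|i].
  have := descent N (leqnn N) y Ty.
  by rewrite /bregman_sum /a; under eq_bigr => i _ do rewrite ltn_ord.
have Tz : T (sigma ((p^-1)%g i)) (zt i).
  by have := Tzt ((p^-1)%g i); rewrite permKV in_setE.
apply: le_trans (descent _ (ltnW (ltn_ord _)) _ Tz).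
by rewrite leeDl// lee_fin bregman_sum_ge0.
Qed.

(** On acceptance, [y0] does at least as well as the accepted trial minimizer. On giving up, [u] is
    [v], and [lyap y0 v <= phi v <= lyap v z]. *)
Lemma linesearch_lyap_le (beta : R) qmax z v d (tau : R) q u y0 :
  linesearch f h g gamma beta qmax z v d tau q u ->
  T (grad hhat u) y0 -> (lyap y0 u <= lyap v z)%E.
Proof.
elim=> {tau q u} [tau q u y _|tau q u y _ _ _ _|//].
  rewrite in_setE => Ty le_y /T_grad_hhatP/(_ y)/le_trans; exact.
move=> /T_grad_hhat_lyap_le/le_trans; apply; exact: phi_le_lyap.
Qed.

(** * Lower semicontinuity of [phi] and stationarity of fixed points of [prox] *)

Lemma phi_lsc : lower_semicontinuous phi.
Proof.
move=> x r; set F := fun y => N%:R^-1 * \sum_i f i y.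
rewrite -[phi x]/((F x)%:E + g x)%E => r_lt.
have cF : {for x, continuous F}.
  have -> : F = N%:R^-1 *: \sum_i f i.
    by apply/funext => y; rewrite /F -[RHS]/(N%:R^-1 * (\sum_i f i) y) fct_sumE.
  apply/differentiable_continuous/differentiableZ/differentiable_sum => i.
  exact: f_differentiable.
(* The slack [e] absorbs the variation of the continuous part near [x]: half the gap if [g x] is
   finite, and 1 if it is infinite. *)
have [e e0 re_lt] : exists2 e, 0 < e & ((r + e - F x)%:E < g x)%E.
  move: r_lt; case: (g x) => [t||].
  - rewrite -EFinD lte_fin => r_lt; exists ((F x + t - r) / 2); first lra.
    by rewrite lte_fin; lra.
  - by move=> _; exists 1; rewrite ?ltry.
  - by rewrite addeNy ltNge leNye.
have [V Vx gV] := g_lsc assum re_lt.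
exists (V `&` [set y | `|F x - F y| < e]).
  by apply: filterI => //; move/cvgrPdist_lt : cF; exact.
move=> y [/gV re_g /=]; rewrite ltr_norml => Fe.
rewrite -[phi y]/((F y)%:E + g y)%E; move: re_g; case: (g y) => [t||].
- by rewrite -EFinD !lte_fin => re_g; lra.
- by move=> _; rewrite addey// ltry.
- by [].
Qed.

(** The fixed-point property bounds [phi x - phi y] by [bregman hhat y x], which is of smaller order
    than the distance from [y] to [x] because [hhat] is differentiable. *)
Lemma prox_regular_subdifferential x :
  phi x \is a fin_num -> prox f h g gamma x x ->
  regular_subdifferential phi x 0.
Proof.
move=> phi_fin prox_x; rewrite /regular_subdifferential/= limf_einfE.
set Q := (fun y : 'rV[R]_n => _).
(* The lower limit is a supremum of infima over deleted neighborhoods, so for each [e] one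
   neighborhood with infimum at least [- e] suffices. *)
apply/lee_addgt0Pr => e e0; rewrite addeC -leeBlDl// sub0e.
have near_x : x^' [set y | y != x /\ bregman hhat y x <= e * `|y - x|].
  have sub_x : (fun y => y - x) @ x --> (0 : 'rV[R]_n).
    rewrite -(subrr x).
    exact: (@cvgB _ _ _ (nbhs x) _ id (fun=> x) x x cvg_id (cvg_cst x)).
  have le_e := sub_x _ (differentiable_grad_le (hhat_differentiable x) e0).
  apply: (@filterS _ (nbhs x) _ _ _ _ le_e) => y /= le_y yx; split=> //.
  by move: le_y; rewrite [x + _]addrC subrK => /(le_trans (ler_norm _)).
apply: le_trans (ereal_sup_ubound _); last first.
  by exists [set y | y != x /\ bregman hhat y x <= e * `|y - x|].
apply: le_ereal_inf_tmp => _ [y [yx le_e] <-]; rewrite /Q.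
have dot0 w : dot (0 : 'rV[R]_n) w = 0.
  by rewrite /dot big1// => j _; rewrite mxE mul0r.
have enorm0 : 0 < enorm (y - x).
  by rewrite (lt_le_trans _ (norm_le_enorm _))// normr_gt0 subr_eq0.
rewrite dot0 sube0 lee_pdivlMr// leeBrDr//.
have := prox_x y; rewrite /= bregmanxx adde0 => le_prox.
rewrite -(fineK phi_fin) -EFinM -EFinD.
move: le_prox; rewrite -{1}(fineK phi_fin).
have := phi_gtNy y; case: (phi y) => [r||] //= _; rewrite ?leey//.
rewrite -EFinD !lee_fin => le_prox.
have := ler_wpM2l (ltW e0) (norm_le_enorm (y - x)).
by lra.
Qed.

(** * Descent and convergence of values along a run *)

Section Run.
Variables (zinit : 'rV[R]_n) (beta : R) (qmax : option nat).
Variables (s z v d u : nat -> 'rV[R]_n) (ztilde : nat -> 'I_N -> 'rV[R]_n).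
Hypothesis N_gt0 : (0 < N)%N.
Hypothesis run : spiral f h g gamma zinit beta qmax s z v d u ztilde.

Lemma spiral_descent k :
  (phi (z k.+1) + (bregman_sum (z k.+1) (ztilde k))%:E <= lyap (v k) (z k))%E /\
  forall i, (phi (ztilde k i) <= lyap (v k) (z k))%E.
Proof.
have loop := spiral_inner run k.
have [p [sigma [sigma0 Tzt _ _]]] := loop.
(* The first inner iterate is a minimizer at [u k], because the loop starts from [grad hhat (u k)];
   [N_gt0] ensures that it exists. *)
have Ty : T (grad hhat (u k)) (ztilde k (p (Ordinal N_gt0))).
  by have := Tzt (Ordinal N_gt0); rewrite in_setE sigma0.
have le_lyap := linesearch_lyap_le (spiral_u run k) Ty.
have [le_z le_zt] := incremental_loop_descent loop Ty.
split=> [|i]; last exact: le_trans (le_zt i) le_lyap.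
apply: le_trans (le_z _ _) le_lyap.
by have := spiral_z run k.+1; rewrite in_setE.
Qed.

Lemma spiral_T_v k : T (grad hhat (z k)) (v k).
Proof. by have := spiral_v run k; rewrite in_setE. Qed.

Lemma lyap_v_le_phi k : (lyap (v k) (z k) <= phi (z k))%E.
Proof. exact/T_grad_hhat_lyap_le/spiral_T_v. Qed.

Lemma lyap_v_succ_le k : (lyap (v k.+1) (z k.+1) <= lyap (v k) (z k) -
  (bregman_sum (z k.+1) (ztilde k))%:E)%E.
Proof.
rewrite leeBrDr//; apply: le_trans (proj1 (spiral_descent k)).
by rewrite leeD2r// lyap_v_le_phi.
Qed.

(** Bounded above by the value at a point where [g] is finite, and below by [phi y]. *)
Lemma T_grad_hhat_lyap_fin x y : T (grad hhat x) y -> lyap y x \is a fin_num.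
Proof.
move=> /T_grad_hhatP Ty.
rewrite fin_real// (lt_le_trans (phi_gtNy y) (phi_le_lyap _ _))/=.
have [_ [w gw]] := g_proper assum; apply: le_lt_trans (Ty w) _.
by rewrite /Defs.lyap !lte_add_pinfty ?ltry.
Qed.

Lemma phi_z_fin k : phi (z k) \is a fin_num.
Proof.
rewrite fin_real// phi_gtNy/=; case: k => [|k].
  have T0 : T (grad hhat zinit) (z 0%N).
    by have := spiral_z run 0; rewrite in_setE (spiral_init run).
  apply: le_lt_trans (phi_le_lyap _ zinit) _.
  by have := T_grad_hhat_lyap_fin T0; rewrite fin_numElt => /andP[].
apply: (@le_lt_trans _ _ (lyap (v k) (z k))).
  by apply: le_trans (proj1 (spiral_descent k)); rewrite leeDl// lee_fin bregman_sum_ge0.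
by have := T_grad_hhat_lyap_fin (spiral_T_v k); rewrite fin_numElt => /andP[].
Qed.

(** Real-valued copies of the two value sequences; they interlace as
    [psi k.+1 <= ell k <= psi k]. *)
Let ell k := fine (lyap (v k) (z k)).
Let psi k := fine (phi (z k)).

Let ellE k : lyap (v k) (z k) = (ell k)%:E.
Proof. by rewrite fineK// T_grad_hhat_lyap_fin//; exact: spiral_T_v. Qed.

Let psiE k : phi (z k) = (psi k)%:E.
Proof. by rewrite fineK// phi_z_fin. Qed.

Let ell_le_psi k : ell k <= psi k.
Proof. by rewrite -lee_fin -ellE -psiE lyap_v_le_phi. Qed.

Let psi_succ_le k : psi k.+1 + bregman_sum (z k.+1) (ztilde k) <= ell k.
Proof. by rewrite -lee_fin EFinD -ellE -psiE; case: (spiral_descent k). Qed.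

Let ell_nonincreasing : nonincreasing_seq ell.
Proof.
apply/nonincreasing_seqP => k; apply: le_trans (ell_le_psi _) _.
by have := psi_succ_le k; have := bregman_sum_ge0 (z k.+1) (ztilde k); lra.
Qed.

Let argmin_phi_le_ell : exists2 x, phi x \is a fin_num &
  forall k, fine (phi x) <= ell k.
Proof.
have [x min_x] := argmin_phi_neq0 assum.
have x_fin : phi x \is a fin_num.
  by rewrite fin_real// phi_gtNy (le_lt_trans (min_x (z 0%N)))// psiE ltry.
exists x => // k; rewrite -lee_fin fineK// -ellE.
exact: le_trans (min_x _) (phi_le_lyap _ _).
Qed.

Let ell_cvg : cvgn ell.
Proof.
apply: nonincreasing_is_cvgn; first exact: ell_nonincreasing.
have [x _ x_le] := argmin_phi_le_ell.
by exists (fine (phi x)) => _ [k _ <-].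
Qed.

Let phistar := limn ell.

Let phistar_le k : phistar <= ell k.
Proof. exact: nonincreasing_cvgn_ge. Qed.

Let psi_cvg : psi @ \oo --> phistar.
Proof.
(* After the shift, [psi k.+1] is squeezed between [ell k.+1] and [ell k]. *)
rewrite -cvg_shiftS.
apply: (@squeeze_cvgr _ _ _ _ (fun k => ell k.+1) ell); last 2 first.
- by rewrite (cvg_shiftS ell); exact: ell_cvg.
- exact: ell_cvg.
near=> k; rewrite ell_le_psi/=.
by have := psi_succ_le k; have := bregman_sum_ge0 (z k.+1) (ztilde k); lra.
Unshelve. all: by end_near. Qed.

(** One term of [bregman_sum] is at most [ell k - ell k.+1], the gap of a convergent sequence. *)
Lemma bregman_ztilde_cvg i : D i (z k.+1) (ztilde k i) @[k --> \oo] --> (0 : R).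
Proof.
apply: (@squeeze_cvgr _ _ _ _ (fun=> 0) (fun k => ell k - ell k.+1)); last 2 first.
- exact: cvg_cst.
- rewrite -(subrr phistar); apply: cvgB; first exact: ell_cvg.
  by rewrite (cvg_shiftS ell); exact: ell_cvg.
near=> k; rewrite bregman_hhat_i_ge0/=.
have D_le : D i (z k.+1) (ztilde k i) <= bregman_sum (z k.+1) (ztilde k).
  rewrite /bregman_sum (bigD1 i)//= lerDl sumr_ge0// => j _.
  exact: bregman_hhat_i_ge0.
by have := psi_succ_le k; have := ell_le_psi k.+1; lra.
Unshelve. all: by end_near. Qed.

(** * Cluster points and boundedness *)

Section ClusterPoint.
Variable zstar : 'rV[R]_n.
Hypothesis zstar_cluster : cluster (z @ \oo) zstar.

(** A strict failure at [zstar] would persist at nearby [z k] by continuity of [bregman hhat w],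
    against the minimality of [v k] and [phistar <= ell k]. *)
Let phistar_le_lyap w : (phistar%:E <= lyap w zstar)%E.
Proof.
rewrite leNgt; apply/negP => lt_star.
have wE : phi w \is a fin_num.
  rewrite fin_real// phi_gtNy (le_lt_trans (phi_le_lyap _ zstar))//.
  by rewrite (lt_trans lt_star) ?ltry.
move: lt_star; rewrite /Defs.lyap -(fineK wE) -EFinD lte_fin => lt_star.
have nbhs_lt : nbhs zstar [set y | fine (phi w) + bregman hhat w y < phistar].
  have := @bregman_hhat_continuous w zstar.
  move/cvgrPdist_lt/(_ _ (etrans (subr_gt0 _ _) lt_star)).
  by apply: filterS => y; rewrite ltr_norml => /andP[? ?]; rewrite /=; lra.
(* The bounds used hold for every [k], so any iterate in the neighborhood will do and no subsequence
   is extracted. *)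
have all_z : (z @ \oo) (range z) by exists 0%N => // k _; exists k.
have [_ [[k _ <-] /=]] := zstar_cluster all_z nbhs_lt.
have /T_grad_hhatP/(_ w) := spiral_T_v k.
rewrite ellE /Defs.lyap -(fineK wE) -EFinD lee_fin.
by have := phistar_le k; lra.
Qed.

Let phi_zstar_le : (phi zstar <= phistar%:E)%E.
Proof.
rewrite leNgt; apply/negP => lt_star.
(* A level strictly between: [psi] is eventually below [r], while lower semicontinuity keeps [phi]
   above [r] near [zstar]. *)
have [r star_r r_lt] : exists2 r, phistar < r & (r%:E < phi zstar)%E.
  move: lt_star; case: (phi zstar) => [t||].
  - by rewrite lte_fin => lt_star; exists ((phistar + t) / 2); rewrite ?lte_fin; lra.
  - by move=> _; exists (phistar + 1); rewrite ?ltry//; lra.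
  - by [].
have [V Vz phi_V] := phi_lsc r_lt.
have lt_r : (z @ \oo) [set x | (phi x < r%:E)%E].
  have psi_lt : \forall k \near \oo, psi k < r.
    exact: (@cvgr_lt _ _ \oo _ _ _ psi_cvg).
  by apply: (@filterS _ \oo _ _ _ _ psi_lt) => k /=; rewrite psiE lte_fin.
have [x [/= phix /phi_V]] := zstar_cluster lt_r Vz.
by rewrite ltNge (ltW phix).
Qed.

Lemma phi_cluster : phi zstar = phistar%:E.
Proof.
apply/eqP; rewrite eq_le phi_zstar_le/=.
by have := phistar_le_lyap zstar; rewrite /Defs.lyap bregmanxx adde0.
Qed.

Lemma prox_cluster : prox f h g gamma zstar zstar.
Proof. by move=> w; rewrite bregmanxx adde0 phi_cluster; exact: phistar_le_lyap. Qed.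

End ClusterPoint.

(** The level [psi 0] bounds every [ell k], which in turn bounds [phi] at [z k.+1] and at each
    [ztilde k i]. *)
Lemma spiral_bounded : level_bounded phi ->
  bounded_set (range z) /\ forall i, bounded_set (range (fun k => ztilde k i)).
Proof.
pose S := [set x | (phi x <= (psi 0%N)%:E)%E].
move=> /(_ (psi 0%N)) S_bounded.
have ell_le k : ell k <= psi 0%N.
  exact: le_trans (ell_nonincreasing (leq0n k)) (ell_le_psi 0).
have sub_bounded (A : set 'rV[R]_n) : A `<=` S -> bounded_set A.
  move=> AS; move: S_bounded; rewrite /= /bounded_near; apply: filterS => M SM x Ax.
  exact/SM/AS.
split=> [|i]; apply: sub_bounded => _ [k _ <-]; rewrite /S/=.
  case: k => [|k]; first by rewrite psiE.
  rewrite psiE lee_fin (le_trans _ (ell_le k))//.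
  by have := psi_succ_le k; have := bregman_sum_ge0 (z k.+1) (ztilde k); lra.
apply: le_trans (proj2 (spiral_descent k) i) _.
by rewrite ellE lee_fin.
Qed.

Lemma spiral_cvg : exists phistar : R,
  [/\ lyap (v k) (z k) @[k --> \oo] --> phistar%:E,
      phi (z k) @[k --> \oo] --> phistar%:E,
      (phistar%:E <= phi (z 0%N))%E,
      (ereal_inf (range phi) <= phistar%:E)%E &
      forall zstar, cluster (z k @[k --> \oo]) zstar ->
        phi zstar = phistar%:E].
Proof.
exists phistar; split.
- apply: cvg_EFin; last exact: ell_cvg.
  by near=> k; rewrite ellE.
- apply: cvg_EFin; last exact: psi_cvg.
  by near=> k; rewrite psiE.
- by rewrite psiE lee_fin (le_trans (phistar_le 0))// ell_le_psi.
- have [x x_fin x_le] := argmin_phi_le_ell.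
  apply: (@le_trans _ _ (phi x)); first by apply: ereal_inf_lbound; exists x.
  rewrite -(fineK x_fin) lee_fin; apply: limr_ge => //.
  by near=> k; exact: x_le.
- exact: phi_cluster.
Unshelve. all: by end_near. Qed.

End Run.
End Spiral.

Unset Implicit Arguments.
Set Strict Implicit.

Theorem theorem4p7 (R : realType) (n N : nat) (N_gt0 : (0 < N)%N)
    (f h : 'I_N -> 'rV[R]_n -> R) (L : 'I_N -> R)
    (g : 'rV[R]_n -> \bar R) (gamma : 'I_N -> R)
    (zinit : 'rV[R]_n) (beta : R) (qmax : option nat)
    (s z v d u : nat -> 'rV[R]_n) (ztilde : nat -> 'I_N -> 'rV[R]_n)
    (assum : standing_assumption f h L g)
    (gammaP : admissible_stepsizes L gamma)
    (betaP : 0 < beta < 1)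
    (run : spiral f h g gamma zinit beta qmax s z v d u ztilde) :
  [/\ forall k,
        (lyap f h g gamma (v k.+1) (z k.+1) <= lyap f h g gamma (v k) (z k) -
           (\sum_i bregman (hhat_ f h gamma i) (z k.+1) (ztilde k i))%:E)%E,
      forall i, bregman (hhat_ f h gamma i) (z k.+1) (ztilde k i)
                  @[k --> \oo] --> (0 : R),
      exists phistar : R,
        [/\ lyap f h g gamma (v k) (z k) @[k --> \oo] --> phistar%:E,
            phi f g (z k) @[k --> \oo] --> phistar%:E,
            (phistar%:E <= phi f g (z 0%N))%E,
            (ereal_inf (range (phi f g)) <= phistar%:E)%E &
            forall zstar, cluster (z k @[k --> \oo]) zstar ->
              phi f g zstar = phistar%:E],
      forall zstar, cluster (z k @[k --> \oo]) zstar ->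
        zstar \in prox f h g gamma zstar /\
        0 \in regular_subdifferential (phi f g) zstar &
      level_bounded (phi f g) ->
        bounded_set (range z) /\
        forall i, bounded_set (range (fun k => ztilde k i))].
Proof.
split.
- by move=> k; exact: (lyap_v_succ_le assum gammaP N_gt0 run k).
- exact: (bregman_ztilde_cvg assum gammaP N_gt0 run).
- exact: (spiral_cvg assum gammaP N_gt0 run).
- move=> zstar zstar_cluster; rewrite !in_setE.
  have prox_zstar := prox_cluster assum gammaP N_gt0 run zstar_cluster.
  split=> //; apply: (prox_regular_subdifferential assum _ prox_zstar).
  (* Finiteness of [phi zstar] comes from its equality with the real limit value. *)
  by rewrite (phi_cluster assum gammaP N_gt0 run zstar_cluster).
- exact: (spiral_bounded assum gammaP N_gt0 run).
Qed.
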